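(* Let $B$ be a left loop with identity $1$, $H$ a group with identity $e$, $l:B\times B\to H$ and $m:B\times H\to H$ mappings, and $\sigma:H\to\mathrm{Sym}_1(B)$, $h\mapsto\sigma_h$, a homomorphism, such that the following conditions hold: (S1) $\sigma_{l(x,y)}=L(x,y)$ for all $x,y\in B$; (S2) $\sigma_{m(x,h)}=\mu_x(\sigma_h)$ for all $x\in B$, $h\in H$; (S3) $l(1,x)=e$ for all $x\in B$; (S4) $m(x,e)=e$ for all $x\in B$; (S5) $l(x,1)=e$ for all $x\in B$; (S6) $m(1,h)=e$ for all $h\in H$; (S7) $l(x\cdot y,L(x,y)z)\,m(z,l(x,y))\,l(x,y)=l(x,y\cdot z)\,l(y,z)$ for all $x,y,z\in B$; (S8) $m(x,hk)=m(\sigma_k(x),h)\,h\,m(x,k)\,h^{-1}$ for all $x\in B$, $h,k\in H$; (S9) $l(\sigma_h(x),(\mu_x(\sigma_h)\sigma_h)(y))\,m(y,m(x,h)h)\,m(x,h)=m(x\cdot y,h)\,h\,l(x,y)\,h^{-1}$ for all $x,y\in B$, $h\in H$. Then the set $B\times H$ with the binary operation $$(x,h)\cdot(y,k)=\big(x\cdot\sigma_h(y),\ l(x,\sigma_h(y))\,m(y,h)\,hk\big)\qquad(x,y\in B,\ h,k\in H)$$ (the external semidirect product $B\rtimes_{(\sigma,l,m)}H$) is a group.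
   Context: A left loop $(B,\cdot)$ is a set with a binary operation such that for each $a\in B$ the left translation $L_a:B\to B$, $L_a x=a\cdot x$, is a bijection, and there is a two-sided identity $1\in B$. $\mathrm{Sym}_1(B)$ is the group of permutations of $B$ fixing $1$. $L(x,y)=L_{x\cdot y}^{-1}L_xL_y$ for $x,y\in B$, and for a permutation $\phi$ of $B$ and $x\in B$, $\mu_x(\phi)=L_{\phi(x)}^{-1}\phi L_x\phi^{-1}$. *)

(* Defs.v *)
From HB Require Import structures.
From mathcomp Require Import all_boot.
From mathcomp Require Import boolp.

Set Implicit Arguments.
Unset Strict Implicit.
Unset Printing Implicit Defensive.

Import Algebra.
Local Open Scope group_scope.

(* The group of all permutations of a (possibly infinite) type, written so that
   (phi * psi) x = phi (psi x). *)
Record Sym (T : Type) := MkSym {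
  sym_fun :> T -> T;
  sym_bij : bijective sym_fun
}.

Section SymGroup.
Variable T : Type.
Implicit Types phi psi : Sym T.

HB.instance Definition _ := gen_eqMixin (Sym T).
HB.instance Definition _ := gen_choiceMixin (Sym T).

Lemma symP phi psi : (forall x, phi x = psi x) -> phi = psi.
Proof.
case: phi psi => [f fb] [g gb] /= /funext fg.
by case: _ / fg gb => gb; congr MkSym; apply: Prop_irrelevance.
Qed.

Definition sym_one : Sym T := MkSym (Bijective (frefl id) (frefl id)).

Definition sym_mul phi psi : Sym T :=
  MkSym (bij_comp (sym_bij phi) (sym_bij psi)).

Lemma sym_inv_subproof phi :
  exists psi : Sym T, cancel phi psi /\ cancel psi phi.
Proof.
case: (sym_bij phi) => g fK gK.
by exists (MkSym (Bijective gK fK)).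
Qed.

Definition sym_inv phi : Sym T := projT1 (cid (sym_inv_subproof phi)).

Lemma sym_funK phi : cancel phi (sym_inv phi).
Proof. by rewrite /sym_inv; case: cid => /= psi []. Qed.

Lemma sym_invK phi : cancel (sym_inv phi) phi.
Proof. by rewrite /sym_inv; case: cid => /= psi []. Qed.

Lemma sym_mulA : associative sym_mul. Proof. by move=> *; apply: symP. Qed.
Lemma sym_1mul : left_id sym_one sym_mul. Proof. by move=> *; apply: symP. Qed.
Lemma sym_mul1 : right_id sym_one sym_mul. Proof. by move=> *; apply: symP. Qed.
Lemma sym_mulV : left_inverse sym_one sym_inv sym_mul.
Proof. by move=> phi; apply: symP => x /=; rewrite sym_funK. Qed.
Lemma sym_Vmul : right_inverse sym_one sym_inv sym_mul.
Proof. by move=> phi; apply: symP => x /=; rewrite sym_invK. Qed.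

HB.instance Definition _ :=
  isGroup.Build (Sym T) sym_mulA sym_1mul sym_mul1 sym_mulV sym_Vmul.

Lemma symM phi psi x : (phi * psi) x = phi (psi x). Proof. by []. Qed.
Lemma sym1 x : (1 : Sym T) x = x. Proof. by []. Qed.
Lemma symVK phi x : phi^-1 (phi x) = x. Proof. exact: sym_funK. Qed.
Lemma symKV phi x : phi (phi^-1 x) = x. Proof. exact: sym_invK. Qed.

End SymGroup.

HB.mixin Record UMagma_isLeftLoop B of UMagma B := {
  mul_bij : forall a : B, bijective (mul a)
}.

#[short(type="leftLoopType")]
HB.structure Definition LeftLoop := {B of UMagma_isLeftLoop B & UMagma B}.

Section LeftLoopTheory.
Variable B : leftLoopType.

Definition fixes_one : {pred Sym B} := [pred phi : Sym B | phi 1 == 1].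

Lemma fixes_one_closed : group_closed fixes_one.
Proof.
split; first by rewrite inE; apply/eqP.
move=> phi psi /eqP phi1 /eqP psi1; apply/eqP.
by rewrite symM -[X in psi^-1 X]psi1 symVK phi1.
Qed.

Record Sym1 := MkSym1 {
  sym1_val :> Sym B;
  _ : sym1_val \in fixes_one
}.

HB.instance Definition _ := [isSub for sym1_val].
HB.instance Definition _ := [Choice of Sym1 by <:].
HB.instance Definition _ :=
  SubChoice_isSubGroup.Build (Sym B) fixes_one Sym1 fixes_one_closed.

Definition ltrans (a : B) : Sym B := MkSym (mul_bij a).

Definition linner (x y : B) : Sym B :=
  (ltrans (x * y))^-1 * ltrans x * ltrans y.

Definition mu (x : B) (phi : Sym B) : Sym B :=
  (ltrans (phi x))^-1 * phi * ltrans x * phi^-1.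

End LeftLoopTheory.

Definition sdprod_mul (B : leftLoopType) (H : groupType)
    (sigma : H -> Sym1 B) (l : B -> B -> H) (m : B -> H -> H)
    (p q : (B * H)%type) : (B * H)%type :=
  let: (x, h) := p in
  let: (y, k) := q in
  (x * sigma h y, l x (sigma h y) * m y h * (h * k)).

(* The operation op on the bare type T is the multiplication of some groupType
   structure on T. *)
Definition is_group (T : Type) (op : T -> T -> T) : Prop :=
  exists G : Group T, @mul (Group.Pack G) = op.

(* Main.v *)
Require Import Defs.
From HB Require Import structures.
From mathcomp Require Import all_boot.
From mathcomp Require Import boolp.
Import Algebra.
Local Open Scope group_scope.

(* Associativity: writing y' = sigma_h y, z' = sigma_k z, w = mu_y(sigma_h) (sigma_h z'),
   conditions (S1), (S2) turn the B-components into (x y') L(x, y') w and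
   x (y' w) = x sigma_h (y z').  In the H-component, (S8) applied twice expands
   m(z, l(x, y') m(y, h) h k), after which (S7) at (x, y', w) and (S9) at (y, z', h)
   reassociate the factors.  Since left translations and the sigma_h are bijective,
   right inverses can be solved for one component at a time. *)

(* The carrier is a variable type, so that HB does not infer the componentwise
   structure that MathComp puts on products. *)
Lemma is_group_rinv (T : Type) (op : T -> T -> T) (e : T) (inv : T -> T) :
  associative op -> left_id e op -> right_id e op -> right_inverse e inv op ->
  is_group op.
Proof.
move=> opA op1l op1r opV.
have opVl : left_inverse e inv op.
  by move=> x; rewrite -[LHS]op1r -(opV (inv x)) opA -(opA (inv x)) opV op1r opV.
pose cT : choiceType := HB.pack T (gen_eqMixin T) (gen_choiceMixin T).
pose G : groupType := HB.pack T (Choice.class cT)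
  (isGroup.Build cT opA op1l op1r opVl opV).
by exists (Group.class G).
Qed.

Section LoopAction.
Variables (B : leftLoopType) (H : groupType) (sigma : {multiplicative H -> Sym1 B}).

Lemma sigmaM h k x : sigma (h * k) x = sigma h (sigma k x).
Proof. by rewrite gmulfM. Qed.

(** [sigma 1] is idempotent in the group [Sym1 B], hence trivial. *)
Lemma sigma_1 x : sigma 1 x = x.
Proof.
by have /mulgI-> : sigma 1 * sigma 1 = sigma 1 * 1 by rewrite -gmulfM !mulg1.
Qed.

Lemma sigma_fix1 h : sigma h 1 = 1.
Proof. by case: (sigma h) => phi /= /eqP. Qed.

Lemma mul_linner (x y z : B) : x * y * linner x y z = x * (y * z).
Proof. exact: (symKV (ltrans (x * y))). Qed.

(** The final [phi^-1] in [mu x phi] absorbs the inner [phi]: [mu x phi] measures how [phi] fails to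
    be multiplicative. *)
Lemma mul_mu (phi : Sym B) (x z : B) : phi x * mu x phi (phi z) = phi (x * z).
Proof. by rewrite /mu !symM symVK; apply: (symKV (ltrans (phi x))). Qed.

End LoopAction.

Theorem theorem5p3 (B : leftLoopType) (H : groupType)
  (l : B -> B -> H) (m : B -> H -> H) (sigma : {multiplicative H -> Sym1 B})
  (S1 : forall x y : B, sigma (l x y) = linner x y :> Sym B)
  (S2 : forall (x : B) (h : H), sigma (m x h) = mu x (sigma h) :> Sym B)
  (S3 : forall x : B, l 1 x = 1)
  (S4 : forall x : B, m x 1 = 1)
  (S5 : forall x : B, l x 1 = 1)
  (S6 : forall h : H, m 1 h = 1)
  (S7 : forall x y z : B,
    l (x * y) (linner x y z) * m z (l x y) * l x y = l x (y * z) * l y z)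
  (S8 : forall (x : B) (h k : H),
    m x (h * k) = m (sigma k x) h * h * m x k * h^-1)
  (S9 : forall (x y : B) (h : H),
    l (sigma h x) ((mu x (sigma h) * sigma h) y) * m y (m x h * h) * m x h
    = m (x * y) h * h * l x y * h^-1) :
  is_group (sdprod_mul sigma l m).
Proof.
(* For [p = (x, h)], [y] solves [x * sigma h y = 1]; then [c * (h * k) = 1], with [c] now known,
   gives [k = h^-1 * c^-1]. *)
pose ri (p : B * H) : B * H :=
  let y := (sigma p.2 : Sym B)^-1 ((ltrans p.1)^-1 1) in
  (y, p.2^-1 * (l p.1 (sigma p.2 y) * m y p.2)^-1).
apply: (@is_group_rinv _ _ (1, 1) ri).
- move=> [x h] [y k] [z j] /=; apply: esym.
  rewrite !sigmaM.
  set y' := sigma h y; set z' := sigma k z.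
  set w := mu y (sigma h) (sigma h z').
  have y'w : y' * w = sigma h (y * z') by apply: mul_mu.
  have -> : sigma (m y h) (sigma h z') = w by rewrite S2.
  have -> : sigma (l x y') w = linner x y' w by rewrite S1.
  congr (_, _); first by rewrite mul_linner y'w.
  set a := l x y'; set b := m y h * h.
  have eq_w : sigma (b * k) z = w by rewrite /b !sigmaM S2.
  have eq_S7 : l (x * y') (linner x y' w) * m w a * a = l x (y' * w) * l y' w.
    exact: S7.
  (* (S9) times [h] on the right, which completes [m y h] to [b]. *)
  have eq_S9 : l y' w * m z' b * b = m (y * z') h * h * l y z'.
    by have := congr1 (mul^~ h) (S9 y z' h); rewrite /= mulgVK -mulgA; apply.
  have -> : a * m y h * (h * k) = a * (b * k) by rewrite /b !mulgA.
  rewrite S8 eq_w S8 -/z' -y'w.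
  clearbody a b.
  (* The [a^-1] and [b^-1] left by (S8) cancel against the factors of [a * (b * k)]. *)
  transitivity (l (x * y') (linner x y' w) * m w a * a *
                (m z' b * b * m z k) * (k * j)).
    by rewrite !mulgA !mulgVK.
  rewrite eq_S7.
  transitivity (l x (y' * w) * (l y' w * m z' b * b) * m z k * (k * j)).
    by rewrite !mulgA.
  by rewrite eq_S9 !mulgA.
- by move=> [y k] /=; rewrite sigma_1 S3 S4 !mul1g.
- by move=> [x h] /=; rewrite sigma_fix1 S5 S6 !mul1g !mulg1.
- move=> [x h]; rewrite /ri /=; congr (_, _); last by rewrite mulVKg mulgV.
  by rewrite symKV; apply: (symKV (ltrans x)).
Qed.
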